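(* Let $n\ge1$ and $e\ge2$ be integers, $l=2$, and let $\mathbf{s}=(s_1,s_2)\in\mathbb{Z}^2$ with $s_2>s_1$. For $N\ge0$ let $\mathsf{m}_e(N):=((q+1)^r,q^{e-1-r})$, where $N=q(e-1)+r$ with $q\ge0$ and $0\le r\le e-2$ (this is the image of the partition $(N)$ under the Mullineux involution in type $A$). Then: 1. (For all $s_2>s_1$.) We have $(\emptyset,(n))_{\theta_{\mathbf{s}}}=(\emptyset,(n))$, and if $j\in\{0,\dots,e-1\}$ satisfies $j\equiv s_2-s_1\pmod e$, then $$((n),\emptyset)_{\theta_{\mathbf{s}}}=\begin{cases}((n),\emptyset)&\text{if }n\le j,\\((j),(n-j))&\text{otherwise.}\end{cases}$$ 2. Assume $s_2\ge s_1+e$. Then $(\emptyset,(1^n))_{\theta_{\mathbf{s}}}=(\emptyset,\mathsf{m}_e(n))$, and if $j\in\{0,\dots,e-1\}$ satisfies $j\equiv s_1+e-s_2\pmod e$, then $$((1^n),\emptyset)_{\theta_{\mathbf{s}}}=\begin{cases}((1^n),\emptyset)&\text{if }n\le j,\\((1^{j}),\mathsf{m}_e(n-j))&\text{otherwise.}\end{cases}$$ 3. Assume $s_1<s_2<s_1+e$, and write $n=q(e-1)+r$ with $q\ge0$ and $0\le r\le e-2$. Then $$(\emptyset,(1^n))_{\theta_{\mathbf{s}}}=\begin{cases}\big(((q+1)^{r-(s_2-s_1)},q^{e-1-r}),\,((q+1)^{s_2-s_1})\big)&\text{if }s_2-s_1\le r,\\ \big((q^{e-1-s_2+s_1}),\,((q+1)^r,q^{s_2-s_1-r})\big)&\text{otherwise,}\end{cases}$$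 $$((1^n),\emptyset)_{\theta_{\mathbf{s}}}=\begin{cases}\big(((q+1)^{s_1+e-s_2}),\,((q+1)^{r-(s_1+e-s_2)},q^{e-1-r})\big)&\text{if }s_1+e-s_2\le r,\\ \big(((q+1)^r,q^{s_1+e-s_2-r}),\,(q^{s_2-1-s_1})\big)&\text{otherwise.}\end{cases}$$
   Context: **Hecke algebra of type $B_n$.** Let $A=\mathbb{C}[u^{\pm1},Q_1,Q_2]$ with $u,Q_1,Q_2$ indeterminates. $\mathcal{H}$ is the associative $A$-algebra generated by $T_0,\dots,T_{n-1}$ with relations $(T_0-Q_1)(T_0-Q_2)=0$, $(T_i-u)(T_i+1)=0$ ($1\le i\le n-1$), $(T_0T_1)^2=(T_1T_0)^2$, $T_iT_{i+1}T_i=T_{i+1}T_iT_{i+1}$ ($1\le i\le n-2$), $T_iT_j=T_jT_i$ ($j\ge i+2$). A $2$-partition of $n$ is a pair $\boldsymbol{\lambda}=(\lambda^1,\lambda^2)$ of partitions of total size $n$ (exponents denote repeated parts; zero parts are ignored; $(0)=(1^0)=\emptyset$). Over $\mathrm{Frac}(A)$ the simple modules of $\mathcal{H}$ are naturally labeled by the $2$-partitions of $n$; they come from $\mathcal{H}$-modules $V^{\boldsymbol{\lambda}}$. The one dimensional ones are: $\boldsymbol{\lambda}=((n),\emptyset)$ and $(\emptyset,(n))$, with $T_i\mapsto u$ for $i\ge1$ and $T_0\mapsto Q_1$, resp. $Q_2$; $\boldsymbol{\lambda}=((1^n),\emptyset)$ and $(\emptyset,(1^n))$, with $T_i\mapsto-1$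 for $i\ge1$ and $T_0\mapsto Q_1$, resp. $Q_2$. **Specialization.** Let $\eta\in\mathbb{C}$ be a primitive $e$-th root of $1$; $\theta_{\mathbf{s}}:A\to\mathbb{C}$ sends $u\mapsto\eta$, $Q_j\mapsto\eta^{s_j}$. The specialized algebra and modules are $\mathbb{C}_{\theta_{\mathbf{s}}}\mathcal{H}$ and $\mathbb{C}_{\theta_{\mathbf{s}}}V^{\boldsymbol{\lambda}}$. **Uglov $2$-partitions.** A node of a $2$-partition is a triple $(a,b,c)$ (row $a$, column $b$, component $c$); its residue is $b-a+s_c$ modulo $e$. A node is addable (resp. removable) for $\boldsymbol{\lambda}$ if adding it to (resp. removing it from) the diagram of $\boldsymbol{\lambda}$ gives the diagram of a $2$-partition. Among addable and removable nodes of a fixed residue $i$, put $(a,b,c)\prec(a',b',c')$ if $b-a+s_c<b'-a'+s_{c'}$, or if these are equal and $c>c'$. Write these nodes in increasing order, with letter $A$ for addable and $R$ for removable, and delete factors $RA$ as long as possible to obtain a word $A^xR^y$. If $x>0$, the node of the rightmost $A$ is the good addable $i$-node. The set $\Phi_{\mathbf{s},e}(n)$ of Uglov $2$-partitions consists of those $2$-partitions of $n$ obtained from $(\emptyset,\emptyset)$ by successively adding $n$ good addable nodes; if their residues are successively $i_1,\dots,i_n$, the $2$-partition is determined by this sequence $(i_1,\dots,i_n)$. **Labels.** The simple $\mathbb{C}_{\theta_{\mathbf{s}}}\mathcal{H}$-modules are labeled by $\Phi_{\mathbf{s},e}(n)$ (canonical basic sets of Geck–Rouquier; crystal of the Fock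 space of charge $\mathbf{s}$): $\mathrm{Irr}(\mathbb{C}_{\theta_{\mathbf{s}}}\mathcal{H})=\{D_{\mathbf{s},e}^{\boldsymbol{\mu}}\mid\boldsymbol{\mu}\in\Phi_{\mathbf{s},e}(n)\}$. If $V^{\boldsymbol{\lambda}}$ is one dimensional, $\boldsymbol{\lambda}_{\theta_{\mathbf{s}}}$ denotes the element of $\Phi_{\mathbf{s},e}(n)$ with $\mathbb{C}_{\theta_{\mathbf{s}}}V^{\boldsymbol{\lambda}}\simeq D_{\mathbf{s},e}^{\boldsymbol{\lambda}_{\theta_{\mathbf{s}}}}$. Concretely, $\boldsymbol{\lambda}_{\theta_{\mathbf{s}}}$ is the Uglov $2$-partition with residue sequence $(s_c,s_c+1,\dots,s_c+n-1)$ modulo $e$ if $\boldsymbol{\lambda}$ has $(n)$ in component $c$ and $\emptyset$ in the other, and $(s_c,s_c-1,\dots,s_c-n+1)$ modulo $e$ if $\boldsymbol{\lambda}$ has $(1^n)$ in component $c$ and $\emptyset$ in the other.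
   Formalization: In item 1, when s_2 < s_1+e and n > j, the formal theorem gives ((n),∅) as the image of ((n),∅) instead of ((j),(n−j)); the printed value is false there, e.g. e=2, n=2, s=(0,1), where the image is ((2),∅). *)

(* Defs.v *)
From HB Require Import structures.
From mathcomp Require Import all_boot all_order all_algebra.
From mathcomp Require Import reals ring.
From mathcomp Require Export complex.

Set Implicit Arguments.
Unset Strict Implicit.
Unset Printing Implicit Defensive.

Import Order.TTheory GRing.Theory Num.Theory.

Local Open Scope ring_scope.

(* A partition is the weakly decreasing list of its nonzero parts; [part]
   puts a weakly decreasing list into this form by dropping its zeros. *)
Definition part (p : seq nat) : seq nat := [seq x <- p | (0 < x)%N].

Definition bipart : Type := (seq nat * seq nat)%type.

(* (a, b, c) = (row, column, component), with a, b >= 1 and c = 1, 2. *)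
Definition node : Type := (nat * nat * nat)%type.

Definition comp (lam : bipart) (c : nat) : seq nat :=
  if c == 1%N then lam.1 else lam.2.

(* the length of row a of p, rows being numbered from 1 *)
Definition row_len (p : seq nat) (a : nat) : nat := nth 0%N p a.-1.

Definition addable (lam : bipart) (g : node) : bool :=
  let: (a, b, c) := g in let p := comp lam c in
  [&& (0 < a)%N, b == (row_len p a).+1 & sorted geq (incr_nth p a.-1)].

Definition removable (lam : bipart) (g : node) : bool :=
  let: (a, b, c) := g in let p := comp lam c in
  [&& (0 < a)%N, (0 < b)%N, b == row_len p a
    & sorted geq (set_nth 0%N p a.-1 b.-1)].

Definition add_node (lam : bipart) (g : node) : bipart :=
  let: (a, b, c) := g in
  if c == 1%N then (incr_nth lam.1 a.-1, lam.2)
  else (lam.1, incr_nth lam.2 a.-1).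

(* A finite list, without repetition, containing all the addable and all the
   removable nodes of lam. *)
Definition nodes (lam : bipart) : seq node :=
  flatten [seq [seq (a, b, c) | a <- iota 1 (size (comp lam c)).+1,
                                b <- iota 1 (row_len (comp lam c) a).+1]
          | c <- [:: 1%N; 2%N]].

Definition charge (s : int * int) (c : nat) : int :=
  if c == 1%N then s.1 else s.2.

Definition content (s : int * int) (g : node) : int :=
  let: (a, b, c) := g in b%:Z - a%:Z + charge s c.

(* Non-strict form of the order on nodes.  Two distinct nodes that are addable
   or removable for the same 2-partition never have both the same content and
   the same component, so [sort] has no ties to break. *)
Definition node_le (s : int * int) (g g' : node) : bool :=
  (content s g < content s g')
  || (content s g == content s g') && (g'.2 <= g.2)%N.

(* Residue classes modulo e are represented by arbitrary integers i. *)
Definition inodes (s : int * int) (e : nat) (i : int) (lam : bipart) :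
    seq node :=
  sort (node_le s)
    [seq g <- nodes lam | (addable lam g || removable lam g)
                          && (content s g == i %[mod e])%Z].

(* Deletes factors RA as long as possible, where [isA] tells the letters A
   from the letters R.  The tail is reduced first; it then has the form
   A^x R^y, and a new first letter R cancels against its first A, if any. *)
Fixpoint cancelRA (T : Type) (isA : pred T) (w : seq T) : seq T :=
  if w is x :: w' then
    let v := cancelRA isA w' in
    if v is y :: v' then
      if ~~ isA x && isA y then v' else x :: v
    else [:: x]
  else [::].

Definition good_addable (s : int * int) (e : nat) (i : int) (lam : bipart) :
    option node :=
  ohead (rev [seq g <- cancelRA (addable lam) (inodes s e i lam)
             | addable lam g]).

Definition add_good (s : int * int) (e : nat) (i : int) (lam : bipart) :
    option bipart :=
  omap (add_node lam) (good_addable s e i lam).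

(* The Uglov 2-partition with residue sequence r, if there is one. *)
Definition uglov (s : int * int) (e : nat) (r : seq int) : option bipart :=
  foldl (fun o i => obind (add_good s e i) o) (Some ([::], [::])) r.

Definition Phi (s : int * int) (e n : nat) (mu : bipart) : Prop :=
  exists2 r : seq int, size r = n & uglov s e r = Some mu.

(* The operators T 0, ..., T n.-1 on V satisfy the defining relations of the
   Hecke algebra of type B_n with parameters u, Q1, Q2 in F, i.e., they make V
   a module over it.  The values T i with n <= i are irrelevant; in particular
   the restriction of a module to the subalgebra of type B_m, m <= n, is given
   by the same T. *)
Definition hecke_module (F : fieldType) (u Q1 Q2 : F) (n : nat)
    (V : vectType F) (T : nat -> 'End(V)) : Prop :=
  [/\ (0 < n)%N ->
        ((T 0%N - Q1 *: \1) \o (T 0%N - Q2 *: \1))%VF = 0,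
      forall i, (1 <= i < n)%N ->
        ((T i - u *: \1) \o (T i + \1))%VF = 0,
      (1 < n)%N ->
        (T 0%N \o T 1%N \o T 0%N \o T 1%N)%VF
        = (T 1%N \o T 0%N \o T 1%N \o T 0%N)%VF,
      forall i, (1 <= i)%N -> (i.+1 < n)%N ->
        (T i \o T i.+1 \o T i)%VF = (T i.+1 \o T i \o T i.+1)%VF
    & forall i j, (i.+2 <= j < n)%N -> (T i \o T j)%VF = (T j \o T i)%VF].

Definition simple_module (F : fieldType) (u Q1 Q2 : F) (n : nat)
    (V : vectType F) (T : nat -> 'End(V)) : Prop :=
  [/\ hecke_module u Q1 Q2 n T,
      fullv != 0%VS :> {vspace V}
    & forall U : {vspace V},
        (forall i, (i < n)%N -> (T i @: U <= U)%VS) ->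
        U = 0%VS \/ U = fullv].

(* [jucys_murphy u T k] is the Jucys-Murphy element
   L_(k+1) = u^(-k) T_k ... T_1 T_0 T_1 ... T_k; it commutes with the
   subalgebra of type B_k. *)
Fixpoint jucys_murphy (F : fieldType) (u : F) (V : vectType F)
    (T : nat -> 'End(V)) (k : nat) : 'End(V) :=
  if k is k'.+1 then
    u^-1 *: (T k \o jucys_murphy u T k' \o T k)%VF
  else T 0%N.

(* [labelled eta s e n mu T] means that the module V given by T is isomorphic
   to the simple module D^mu over the specialized algebra u = eta,
   Q_j = eta^(s_j).  The labelling is the one for which the modular branching
   graph is the crystal of the Fock space of charge s: D^(empty, empty) is the
   one dimensional module of the algebra of rank 0, and if mu is obtained from
   nu by adding the good addable i-node, then D^nu is the socle of the
   i-restriction of D^mu.  As the algebra of rank n commutes with L_(n+1), a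
   simple module lies in that socle if and only if it embeds into the
   restriction of D^mu with L_(n+1) acting on its image as eta^i. *)
Fixpoint labelled (F : fieldType) (eta : F) (s : int * int) (e n : nat)
    (mu : bipart) (V : vectType F) (T : nat -> 'End(V)) : Prop :=
  simple_module eta (eta ^ s.1) (eta ^ s.2) n T /\
  if n is n'.+1 then
    exists (nu : bipart) (i : int) (W : vectType F) (S : nat -> 'End(W))
           (f : 'Hom(W, V)),
      [/\ labelled eta s e n' nu S,
          add_good s e i nu = Some mu,
          lker f == 0%VS,
          (forall k, (k < n')%N -> (T k \o f)%VF = (f \o S k)%VF)
        & (jucys_murphy eta T n' \o f)%VF = eta ^ i *: f]
  else mu = ([::], [::]).

(* The scalar by which T_i acts on the one dimensional V^lam, for lam one of
   ((n), empty), (empty, (n)), ((1^n), empty), (empty, (1^n)) with n >= 1.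
   V^lam is defined over the ring generated by u^(+-1), Q1 and Q2, so
   specializing it amounts to evaluating u, Q1 and Q2. *)
Definition one_dim_scalar (F : fieldType) (u Q1 Q2 : F) (lam : bipart)
    (i : nat) : F :=
  if i == 0%N then (if lam.2 == [::] then Q1 else Q2)
  else (if size (lam.1 ++ lam.2) == 1%N then u else - 1).

Definition one_dim_module (F : fieldType) (u Q1 Q2 : F) (lam : bipart)
    (i : nat) : 'End(F^o) :=
  one_dim_scalar u Q1 Q2 lam i *: \1%VF.

(* lam_(theta_s) = mu, for one dimensional V^lam: mu is the element of
   Phi_(s,e)(n) such that the specialization of V^lam is isomorphic to D^mu. *)
Definition theta_image (F : fieldType) (eta : F) (s : int * int) (e n : nat)
    (lam mu : bipart) : Prop :=
  forall mu' : bipart,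
    Phi s e n mu' /\
    labelled eta s e n mu' (one_dim_module eta (eta ^ s.1) (eta ^ s.2) lam)
    <-> mu' = mu.

(* The image of (N) under the Mullineux involution. *)
Definition mullineux_row (e N : nat) : seq nat :=
  let q := (N %/ e.-1)%N in let r := (N %% e.-1)%N in
  part (nseq r q.+1 ++ nseq (e.-1 - r) q).

Lemma add_good_mod s (e : nat) i i' lam : (i = i' %[mod e])%Z ->
  add_good s e i lam = add_good s e i' lam.
Proof.
move=> h; rewrite /add_good /good_addable /inodes; congr (omap _ (ohead (rev [seq g <- cancelRA _ (sort _ _) | _]))).
by apply: eq_filter => g /=; rewrite h.
Qed.

Lemma uglov_rcons s e r i :
  uglov s e (rcons r i) = obind (add_good s e i) (uglov s e r).
Proof. by rewrite /uglov -cats1 foldl_cat. Qed.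

Section OneDimensional.
Variables (F : fieldType) (eta : F) (s : int * int) (e : nat).
Hypothesis he : e.-primitive_root eta.

Lemma eta0 : eta != 0.
Proof.
apply/eqP => h; have := prim_expr_order he; rewrite h expr0n.
have := prim_order_gt0 he; case: e => // k _ /= /eqP; by rewrite eq_sym oner_eq0.
Qed.

Lemma exp_eta i i' : eta ^ i = eta ^ i' -> (i = i' %[mod e])%Z.
Proof.
have U : eta \is a GRing.unit by rewrite unitfE eta0.
have e0 : (e%:Z != 0 :> int) by rewrite eqz_nat -lt0n (prim_order_gt0 he).
have H x : eta ^ x = eta ^ (x %% e)%Z.
  rewrite {1}(divz_eq x e) expfzDr ?eta0 // [X in eta ^ X * _]mulrC -exprz_exp.
  by rewrite -(exprnP eta e) (prim_expr_order he) exp1rz mul1r.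
rewrite H [RHS]H.
have := modz_ge0 i e0; have := modz_ge0 i' e0.
have := ltz_pmod i (_ : 0 < e%:Z); have := ltz_pmod i' (_ : 0 < e%:Z).
rewrite ltz_nat (prim_order_gt0 he) => /(_ isT) + /(_ isT).
case: (modz i e) => // a; case: (modz i' e) => // b + + _ _.
rewrite !ltz_nat => hb ha /eqP.
rewrite -!exprnP (eq_prim_root_expr he) !modn_small //.
by move/eqP->.
Qed.

(* the scalar by which L_(k+1) acts when each T_i acts by the scalar chi i *)
Fixpoint ell (chi : nat -> F) (k : nat) : F :=
  if k is k'.+1 then eta^-1 * (chi k * ell chi k' * chi k)
  else chi 0%N.

Lemma jm_scal (V : vectType F) (T : nat -> 'End(V)) chi k :
  (forall i, (i <= k)%N -> T i = chi i *: \1%VF) -> jucys_murphy eta T k = ell chi k *: \1%VF.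
Proof.
elim: k => [|k IH] h /=; first by rewrite h.
rewrite IH => [|i hi]; last by apply/h/leqW.
rewrite h //; apply/lfunP => v.
rewrite !(scale_lfunE, comp_lfunE, id_lfunE) !scalerA; congr (_ *: v); ring.
Qed.

Lemma dim1_simple u Q1 Q2 n (V : vectType F) (T : nat -> 'End(V)) :
  \dim {:V} = 1%N -> hecke_module u Q1 Q2 n T -> simple_module u Q1 Q2 n T.
Proof.
move=> d h; split=> // [|U _]; first by rewrite -dimv_eq0 d.
have := dimvS (subvf U); rewrite d.
case hU: (\dim U) => [|[|//]] _.
  by left; apply/eqP; rewrite -dimv_eq0 hU.
by right; apply/eqP; rewrite eqEdim subvf d hU.
Qed.

Lemma hecke_leq u Q1 Q2 m n (V : vectType F) (T : nat -> 'End(V)) : (m <= n)%N ->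
  hecke_module u Q1 Q2 n T -> hecke_module u Q1 Q2 m T.
Proof.
move=> h [A B C D E]; split.
- by move=> hm; apply: A; apply: leq_trans h.
- by move=> i /andP[h1 h2]; apply: B; rewrite h1 (leq_trans h2 h).
- by move=> hm; apply: C; apply: leq_trans h.
- by move=> i h1 h2; apply: D => //; apply: leq_trans h.
- by move=> i j /andP[h1 h2]; apply: E; rewrite h1 (leq_trans h2 h).
Qed.

Lemma labelled_scalar n mu chi (r : seq int) (V : vectType F) (T : nat -> 'End(V)) :
  \dim {:V} = 1%N -> hecke_module eta (eta ^ s.1) (eta ^ s.2) n T ->
  size r = n ->
  (forall k, (k < n)%N -> T k = chi k *: \1%VF) ->
  (forall k, (k < n)%N -> ell chi k = eta ^ (nth 0 r k)) ->
  labelled eta s e n mu T <-> uglov s e r = Some mu.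
Proof.
elim: n mu r V T => [|n IH] mu r V T d hm sr hT hr.
  move/size0nil: sr => ->; rewrite /uglov /=; split=> [[_ ->]//|[<-]].
  by split=> //; apply: dim1_simple.
case/lastP: r sr hr => [//|r i]; rewrite size_rcons => -[sr] hr.
have hi : ell chi n = eta ^ i by rewrite hr // nth_rcons sr ltnn eqxx.
have hr' k : (k < n)%N -> ell chi k = eta ^ (nth 0 r k).
  by move=> kn; rewrite hr ?nth_rcons ?sr ?kn //; apply: leqW.
have hjm : jucys_murphy eta T n = ell chi n *: \1%VF by apply: jm_scal => k hk; apply: hT.
rewrite uglov_rcons; split=> [[_ [nu [i' [W [S [f [l1 l2 l3 l4 l5]]]]]]]|].
  have [hS W0 _] : simple_module eta (eta ^ s.1) (eta ^ s.2) n S by case: (n) l1 => [|?] [].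
  have dW : \dim {:W} = 1%N.
    have := limg_ker_dim f fullv; rewrite (eqP l3) capv0 dimv0 add0n => <-.
    apply/eqP; rewrite eqn_leq; rewrite -{1}d dimvS ?subvf //=.
    rewrite lt0n dimv_eq0; apply: contraNN W0 => /eqP h.
    rewrite -subv0 -(eqP l3); apply/subvP => v _; rewrite memv_ker.
    by have := memv_img f (memvf v); rewrite h memv0.
  have inj : injective f by apply/lker0P.
  have hS' k : (k < n)%N -> S k = chi k *: \1%VF.
    move=> kn; apply/lfunP => v; apply: inj.
    have := l4 k kn => /lfunP/(_ v); rewrite !comp_lfunE => <-.
    by rewrite hT ?(leqW kn) // !scale_lfunE !id_lfunE linearZ.
  have /(_ nu r W S dW hS sr hS' hr') [/(_ l1) -> _] := IH.
  rewrite -l2 /=; apply: add_good_mod; apply: exp_eta; rewrite -hi.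
  have [v v0] : exists v : W, v != 0.
    by exists (vpick fullv); rewrite vpick0.
  move/lfunP/(_ v): l5; rewrite hjm comp_lfunE !scale_lfunE id_lfunE.
  move/eqP; rewrite -subr_eq0 -scalerBl scaler_eq0 subr_eq0 => /orP[/eqP//|].
  by rewrite -(linear0 f) (inj_eq inj) (negPf v0).
case hu: (uglov s e r) => [nu|//] /= hmu; split; first exact: dim1_simple.
have hm' := hecke_leq (leqnSn n) hm.
exists nu, i, V, T, \1%VF; split=> //.
- by apply/(IH nu r V T d hm' sr _ hr') => // k kn; apply: hT; apply: leqW.
- by apply/eqP/vspaceP=> v; rewrite memv_ker id_lfunE memv0.
- by move=> k _; rewrite comp_lfun1l comp_lfun1r.
- by rewrite hjm comp_lfun1r hi.
Qed.

End OneDimensional.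

(* The residues of the nodes of the row or column lam, in order. *)
Definition one_dim_residues (s : int * int) n (lam : bipart) : seq int :=
  let sc := if lam.2 == [::] then s.1 else s.2 in
  [seq (if size (lam.1 ++ lam.2) == 1%N then sc + k%:Z else sc - k%:Z) | k <- iota 0 n].

(* For one dimensional V^lam, lam_(theta_s) is the Uglov 2-partition with the
   residue sequence of lam. *)
Lemma theta_image_residues (F : fieldType) (eta : F) s e n lam mu :
  e.-primitive_root eta ->
  uglov s e (one_dim_residues s n lam) = Some mu -> theta_image eta s e n lam mu.
Proof.
move=> he hmu mu'.
have e0 := eta0 he.
have ue : eta \is a GRing.unit by rewrite unitfE.
set Q1 := eta ^ s.1; set Q2 := eta ^ s.2.
set chi := one_dim_scalar eta Q1 Q2 lam.
have L : labelled eta s e n mu' (one_dim_module eta Q1 Q2 lam) <-> uglov s e (one_dim_residues s n lam) = Some mu'.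
  apply: (@labelled_scalar _ _ _ _ he _ _ chi) => //.
  - by rewrite dimvf.
  - split.
    + move=> _; apply/lfunP=> v; rewrite /one_dim_module /one_dim_scalar /=.
      by case: ifP => _; rewrite subrr ?comp_lfun0l ?comp_lfun0r zero_lfunE.
    + move=> i /andP[i0 _]; rewrite /one_dim_module /one_dim_scalar -[i == _]negbK -lt0n i0 /=.
      by case: ifP => _; rewrite ?subrr ?comp_lfun0l // scaleN1r addNr comp_lfun0r.
    + move=> _; apply/lfunP => v; rewrite !(comp_lfunE, scale_lfunE, id_lfunE) !scalerA; congr (_ *: v); ring.
    + move=> i i0 _; rewrite /one_dim_module /one_dim_scalar -[i == _]negbK -lt0n i0 /=. by [].
    + move=> i j _; apply/lfunP => v; rewrite !(comp_lfunE, scale_lfunE, id_lfunE) !scalerA; congr (_ *: v); ring.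
  - by rewrite size_map size_iota.
  - move=> k kn; rewrite (nth_map 0%N) ?size_iota // nth_iota // add0n.
    elim: k kn => [|k IH] kn /=.
      rewrite /chi /one_dim_scalar /=; by do 2![case: ifP => _]; rewrite ?subr0 ?addr0.
    rewrite IH ?(ltnW kn) // /chi /one_dim_scalar /=.
    set sc := if lam.2 == [::] then s.1 else s.2.
    case: ifP => _; rewrite -addn1 PoszD ?opprD !addrA expfzDr //.
      rewrite !(expfzDr _ _ e0) -!exprnP expr1; set A := eta ^ sc; set B := eta ^+ k; field; exact: e0.
    transitivity (eta ^ (sc - k%:Z - 1)); last by [].
    by rewrite !(expfzDr _ _ e0) exprN1; ring.
rewrite L hmu; split=> [[_ [->]]//|->]; split=> //.
by exists (one_dim_residues s n lam) => //; rewrite size_map size_iota.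
Qed.

(* When s_1 < s_2 < s_1 + e, the 2-partition ((j), (n - j)) with j = s_2 - s_1
   and n > j may fail to be an Uglov 2-partition: after j steps the nodes
   (1, j+1, 1) and (1, 1, 2) have the same content, and the good addable node
   is the one in component 1. *)
Lemma Phi_charge01 : ~ Phi (0, 1) 2 2 ([:: 1%N], [:: 1%N]).
Proof.
case=> [[|i [|j [|]]]] //= _.
rewrite /uglov /= (@add_good_mod _ _ i (i %% 2)%Z) ?modz_mod //.
have H x : (x %% 2)%Z = 0 \/ (x %% 2)%Z = 1.
  have := modz_ge0 x (isT : 2 != 0 :> int); have := ltz_pmod x (isT : 0 < 2 :> int).
  by case: (modz x 2) => [[|[|]]|] //; [left|right].
case E: (add_good _ _ _ _) => [nu|//] /=.
rewrite (@add_good_mod _ _ j (j %% 2)%Z) ?modz_mod //.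
by case: (H i) E => -> E; vm_compute in E; case: E => <-; case: (H j) => ->; vm_compute.
Qed.

(* Main.v *)
Require Import Defs.
From mathcomp Require Import all_boot all_order all_algebra.
From mathcomp Require Import reals.
From mathcomp Require Import zify.

Set Implicit Arguments.
Unset Strict Implicit.
Unset Printing Implicit Defensive.

Import Order.TTheory GRing.Theory Num.Theory.

Local Open Scope ring_scope.

(* For a one dimensional V^lam the Uglov 2-partition is read off the residue
   sequence of lam.  Every 2-partition met along the way has both components of
   the form ((q+1)^a, q^b), and the node to be added is (a+1, q+1, c) for one of
   the components c.  It has the largest content among the addable and
   removable nodes of its residue, and the only removable node of that residue
   that may occur cancels against the addable node at the bottom of
   component c. *)

(** * Congruences modulo [e] and deletion of factors RA *)

Lemma eqz_mod_gap (e : nat) (x y : int) :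
  (x == y %[mod e])%Z -> x < y + e%:Z -> y < x + e%:Z -> x = y.
Proof.
rewrite eqz_mod_dvd => /dvdzP[k hk] h1 h2.
have : k = 0 by nia.
by move=> k0; move: hk; rewrite k0 mul0r; lia.
Qed.

(** An A is deleted only against an R to its left, so leading letters A survive. *)
Lemma cancelRA_cat (T : Type) (isA : pred T) (u v : seq T) :
  all isA u -> cancelRA isA (u ++ v) = u ++ cancelRA isA v.
Proof.
elim: u => //= x u IH /andP[hx /IH ->].
by case: (u ++ _) => //= y w; rewrite hx.
Qed.

Lemma cancelRA_all (T : Type) (isA : pred T) (u : seq T) :
  all isA u -> cancelRA isA u = u.
Proof. by move=> hu; rewrite -[u in LHS]cats0 cancelRA_cat //= cats0. Qed.

Lemma cancelRA_RA (T : Type) (isA : pred T) (x y : T) (u : seq T) :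
  ~~ isA x -> isA y -> all isA u -> cancelRA isA [:: x, y & u] = u.
Proof.
(* The fixpoint is unfolded only once, so that [cancelRA_all] still applies to the tail. *)
move=> hx hy hu; rewrite -[LHS]/(let v := cancelRA isA (y :: u) in
  if v is z :: v' then if ~~ isA x && isA z then v' else x :: v else [:: x]).
by rewrite cancelRA_all /= ?hx ?hy.
Qed.

(** * Ordered words of nodes and a criterion for the good addable node *)

Lemma node_le_total s : total (node_le s).
Proof. by move=> g h; rewrite /node_le; lia. Qed.

Lemma node_le_trans s : transitive (node_le s).
Proof. by move=> g f h; rewrite /node_le; lia. Qed.

Lemma nodes_uniq lam : uniq (nodes lam).
Proof.
pose N c := [seq (a, b, c) | a <- iota 1 (size (Defs.comp lam c)).+1,
                             b <- iota 1 (row_len (Defs.comp lam c) a).+1].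
have U c : uniq (N c).
  apply: allpairs_uniq_dep => [|a _|]; rewrite ?iota_uniq //.
  by move=> [a b] [a' b'] _ _ /= [-> ->].
rewrite [nodes lam](_ : _ = N 1%N ++ N 2%N); last by rewrite -[N 2%N]cats0.
rewrite cat_uniq !U andbT; apply/hasPn => g.
case/allpairsPdep=> a [b [_ _ ->]]; apply/negP.
by case/allpairsPdep=> a' [b' [_ _ []]].
Qed.

Lemma mem_inodes s e i lam g :
  (g \in inodes s e i lam) =
  [&& addable lam g || removable lam g, (content s g == i %[mod e])%Z
    & g \in nodes lam].
Proof. by rewrite mem_sort mem_filter andbA. Qed.

(* The criterion covers i-words of the forms A...A and A...A R A...A A. *)
Lemma good_addable_last s e i lam g :
  g \in inodes s e i lam -> addable lam g ->
  (forall h, h \in inodes s e i lam -> h != g -> ~~ node_le s g h) ->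
  (forall h h', h \in inodes s e i lam -> h' \in inodes s e i lam ->
     ~~ addable lam h -> ~~ addable lam h' -> h = h') ->
  (forall h, h \in inodes s e i lam -> ~~ addable lam h ->
     exists k, [/\ k \in inodes s e i lam, k != g & ~~ node_le s k h]) ->
  good_addable s e i lam = Some g.
Proof.
move=> gw gA gmax Runiq Rk; rewrite /good_addable.
have sw : pairwise (node_le s) (inodes s e i lam).
  rewrite -sorted_pairwise; last exact: node_le_trans.
  exact/sort_sorted/node_le_total.
have uw : uniq (inodes s e i lam) by rewrite sort_uniq filter_uniq ?nodes_uniq.
(* Nothing follows [g]: by sortedness a later node would be above [g], against maximality. *)
have [w ew] : exists w, inodes s e i lam = rcons w g.
  case/splitPr: gw gmax sw uw => w v gmax + uw.
  rewrite pairwise_cat pairwise_cons => /and3P[_ _ /andP[hv _]].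
  exists w; case: v hv gmax uw => [|h v] /= hv gmax; first by rewrite cats1.
  rewrite cat_uniq => /and3P[_ _ /= /andP[]]; rewrite inE negb_or => /andP[gh _] _.
  have := gmax h; rewrite mem_cat !inE eqxx !orbT eq_sym gh => /(_ isT isT).
  by case/andP: hv => ->.
have good u : cancelRA (addable lam) (rcons w g) = rcons u g ->
    ohead (rev [seq h <- cancelRA (addable lam) (rcons w g) | addable lam h])
    = Some g.
  by move=> ->; rewrite filter_rcons gA rev_rcons.
rewrite ew in gmax Runiq Rk sw uw *.
have [wA|] := boolP (all (addable lam) w).
  by apply: (good w); rewrite -cats1 cancelRA_cat.
rewrite -has_predC => /hasP[h hw /= hR]; have hw' : h \in rcons w g.
  by rewrite mem_rcons inE hw orbT.
case/splitPr: hw Runiq Rk sw uw good hw' {ew gw gmax} => u v Runiq Rk.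
rewrite rcons_cat rcons_cons in Runiq Rk *.
rewrite cat_uniq pairwise_cat pairwise_cons /=.
move=> /and4P[/allrelP ruv _ _ _] /and3P[_ /norP[hu _] /andP[hv _]] good hw.
have uA : all (addable lam) u.
  apply/allP => x xu; apply/negPn/negP => xR; case/negP: hu.
  by rewrite -(Runiq x h) // mem_cat xu.
have vA : all (addable lam) v.
  apply/allP => x xv; apply/negPn/negP => xR; case/negP: hv.
  rewrite -(Runiq x h) ?mem_rcons ?inE ?xv ?orbT // mem_cat inE mem_rcons inE xv.
  by rewrite !orbT.
have [k [kw kg kh]] := Rk h hw hR.
(* As [k] is not below the R-node [h], it stands to the right of [h]; hence [v] is nonempty and its
   first letter cancels [h]. *)
have : k \in v.
  move: kw; rewrite mem_cat inE mem_rcons inE (negPf kg) /= => /or3P[ku|/eqP kE|//].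
    by case/negP: kh; apply: ruv; rewrite ?inE ?eqxx.
  by case/negP: kh; rewrite kE; have := node_le_total s h h; rewrite orbb.
case: v vA {Runiq Rk ruv hv hw kw} good => [//|y v] /andP[yA vA] good _.
apply: (good (u ++ v)); rewrite cancelRA_cat // rcons_cat; congr (_ ++ _).
by rewrite cancelRA_RA // all_rcons gA.
Qed.

(** * Partitions with parts [q.+1] and [q] only, and their corners *)

Lemma sorted_geq_nthP p :
  reflect (forall k, (nth 0%N p k.+1 <= nth 0%N p k)%N) (sorted geq p).
Proof.
apply: (iffP (sortedP 0%N)) => h k; last by move=> _; exact: h.
by case: (ltnP k.+1 (size p)) => [/h//|?]; rewrite nth_default.
Qed.

(** For [q = 0] the last [b] parts vanish and [b] is a mere counter, so the first column can be
    treated like the later ones. *)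
Definition block (q a b : nat) : seq nat := part (nseq a q.+1 ++ nseq b q).

Lemma blockE q a b : block q a b = nseq a q.+1 ++ nseq ((0 < q) * b) q.
Proof. by rewrite /block /part filter_cat !filter_nseq mul1n. Qed.

Lemma nth_block q a b k : nth 0%N (block q a b) k =
  if (k < a)%N then q.+1 else if (k < a + b)%N then q else 0%N.
Proof.
rewrite blockE nth_cat size_nseq !nth_nseq.
by case: q => [|q] /=; do ?case: ifP; lia.
Qed.

Lemma size_block q a b : size (block q a b) = (a + (0 < q) * b)%N.
Proof. by rewrite blockE size_cat !size_nseq. Qed.

(** A finished column is the initial stage of the next one; row paths and the passage from [q] to
    [q.+1] rest on this. *)
Lemma block_col q a : block q a 0 = block q.+1 0 a.
Proof. by rewrite !blockE muln0 /= mul1n cats0. Qed.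

Lemma block_fill q a b : (0 < b)%N || (q == 0%N) ->
  incr_nth (block q a b) a = block q a.+1 b.-1.
Proof.
move=> h; apply: (@eq_from_nth _ 0%N) => [|k _].
  by rewrite size_incr_nth !size_block; case: q h => [|q]; case: ifP; lia.
by rewrite nth_incr_nth !nth_block; do ?case: ifP; lia.
Qed.

Section BlockNodes.
Variables (lam : bipart) (c q a b : nat).
Hypothesis lamc : Defs.comp lam c = block q a b.

(** The corners are the end of row 1, the step from parts [q.+1] to parts [q], and the first empty
    row; the guards discard coinciding or absent ones. *)
Lemma addable_block x y : addable lam (x, y, c) =
  [|| [&& (0 < a)%N, x == 1%N & y == q.+2],
      [&& (0 < b)%N || (q == 0%N), x == a.+1 & y == q.+1]
    | [&& (0 < q)%N, x == (a + b).+1 & y == 1%N]].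
Proof.
rewrite /addable lamc /row_len nth_block; apply/idP/idP.
  case: x => //= x /andP[/eqP-> /sorted_geq_nthP h].
  case: x h => [|x] h; first by do ?case: ifP; lia.
  move: (h x); rewrite !nth_incr_nth !nth_block eqxx gtn_eqF //.
  do ?case: ifP; lia.
move=> h; apply/and3P; split; first by lia.
  by move: h; do ?case: ifP; lia.
apply/sorted_geq_nthP => k; rewrite !nth_incr_nth !nth_block.
by do ?case: ifP; move: h; lia.
Qed.

Lemma removable_block x y : removable lam (x, y, c) ->
  [&& (0 < a)%N, x == a & y == q.+1]
  || [&& (0 < b)%N, (0 < q)%N, x == (a + b)%N & y == q].
Proof.
rewrite /removable lamc /row_len nth_block.
case: x => //= x /and3P[y0 /eqP yE /sorted_geq_nthP/(_ x)].
by rewrite !nth_set_nth /= eqxx gtn_eqF // nth_block; move: y0 yE; do ?case: ifP; lia.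
Qed.

Lemma addable_block_mem x y : (c == 1%N) || (c == 2%N) ->
  addable lam (x, y, c) -> (x, y, c) \in nodes lam.
Proof.
move=> hc hA; apply/flattenP.
exists [seq (x, y, c) | x <- iota 1 (size (Defs.comp lam c)).+1,
                        y <- iota 1 (row_len (Defs.comp lam c) x).+1].
  by apply/mapP; exists c; rewrite // !inE.
apply/allpairsPdep; exists x, y; split=> //; last first.
  by move: hA => /and3P[_ /eqP -> _]; rewrite mem_iota; lia.
rewrite mem_iota lamc size_block; move: hA; rewrite addable_block.
by case: (q) => [|q']; lia.
Qed.

End BlockNodes.

(* In [addable_contents] and [removable_contents] the charge is omitted. *)
Definition addable_contents (q a b : nat) : seq int :=
  nseq (0 < a)%N (q%:Z + 1) ++ nseq ((0 < b) || (q == 0))%N (q%:Z - a%:Z)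
  ++ nseq (0 < q)%N (- (a + b)%:Z).

Definition removable_contents (q a b : nat) : seq int :=
  nseq (0 < a)%N (q%:Z + 1 - a%:Z)
  ++ nseq ((0 < b) && (0 < q))%N (q%:Z - (a + b)%:Z).

(** In component [c], the bounds [a.+1 < e] and [b < e] put the removable nodes and the addable end
    of row 1 (when [a > 0]) at nonzero distance less than [e] from [G], hence off its residue. Only
    the new node and possibly the bottom one remain, both addable. The assumptions on [c'] keep its
    addable nodes below the new node and admit at most one removable node, which the bottom node of
    [c] must follow. *)
Lemma good_addable_block s e lam c c' q a b q' a' b'
    (G : int := q%:Z - a%:Z + charge s c) :
  (c == 1%N) && (c' == 2%N) || (c == 2%N) && (c' == 1%N) ->
  Defs.comp lam c = block q a b -> Defs.comp lam c' = block q' a' b' ->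
  (a.+1 < e)%N -> (b < e)%N -> (0 < b)%N || (q == 0%N) ->
  (forall x, x \in addable_contents q' a' b' ->
     (x + charge s c' == G %[mod e])%Z ->
     (x + charge s c' < G) || (c == 1%N) && (x + charge s c' == G)) ->
  (forall x, x \in removable_contents q' a' b' ->
     (x + charge s c' == G %[mod e])%Z ->
     [&& (0 < q)%N, (charge s c - (a + b)%:Z == G %[mod e])%Z,
         x + charge s c' < charge s c - (a + b)%:Z
       & ~~ [&& (0 < a')%N, (0 < b')%N & (0 < q')%N]]) ->
  good_addable s e G lam = Some (a.+1, q.+1, c).
Proof.
move=> cc' lamc lamc' ae be bq hA hR.
have c12 : (c == 1%N) || (c == 2%N) by lia.
have cN : c != c' by lia.
have gA : addable lam (a.+1, q.+1, c).
  by rewrite (addable_block lamc) bq !eqxx orbT.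
have cP h : h \in inodes s e G lam -> h.2 = c \/ h.2 = c'.
  rewrite mem_inodes => /and3P[_ _ /flattenP[l /mapP[d + ->] /allpairsPdep]].
  by rewrite !inE => dP [x [y [_ _ ->]]] /=; lia.
have gap x y : (x, y, c) \in inodes s e G lam ->
    y%:Z - x%:Z < q%:Z - a%:Z + e%:Z -> q%:Z - a%:Z < y%:Z - x%:Z + e%:Z ->
    y%:Z - x%:Z = q%:Z - a%:Z.
  by rewrite mem_inodes => /and3P[_ /eqz_mod_gap + _]; rewrite /= /G; lia.
have ownA x y : (x, y, c) \in inodes s e G lam -> addable lam (x, y, c).
  move=> h; have := gap _ _ h; move: h; rewrite mem_inodes => /andP[+ _].
  case/orP=> // /(removable_block lamc); lia.
have own x y : (x, y, c) \in inodes s e G lam ->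
    (x == a.+1) && (y == q.+1) || (y%:Z - x%:Z + charge s c < G).
  move=> h; have := ownA _ _ h; rewrite (addable_block lamc).
  by move: (gap _ _ h); rewrite /G; lia.
have other x y : (x, y, c') \in inodes s e G lam -> addable lam (x, y, c') ->
  (y%:Z - x%:Z + charge s c' < G)
  || (c == 1%N) && (y%:Z - x%:Z + charge s c' == G).
  rewrite mem_inodes => /and3P[_ hG _]; rewrite (addable_block lamc') => h.
  apply: (hA (y%:Z - x%:Z)) hG; rewrite !mem_cat !mem_nseq !lt0b.
  by move: h; clear; lia.
have rem x y : (x, y, c') \in inodes s e G lam -> ~~ addable lam (x, y, c') ->
  [&& (0 < q)%N, (charge s c - (a + b)%:Z == G %[mod e])%Z,
         y%:Z - x%:Z + charge s c' < charge s c - (a + b)%:Z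
       & ~~ [&& (0 < a')%N, (0 < b')%N & (0 < q')%N]] /\
  removable lam (x, y, c').
  rewrite mem_inodes => /and3P[+ hG _] hN; rewrite (negPf hN) => h.
  split=> //; apply: (hR (y%:Z - x%:Z)) hG; rewrite !mem_cat !mem_nseq !lt0b.
  by move/(removable_block lamc'): h; clear; lia.
apply: good_addable_last => //.
- rewrite mem_inodes gA (addable_block_mem lamc) // andbT.
  by rewrite [content _ _](_ : _ = G) // /G /=; lia.
- move=> [[x y] d] hi hn; rewrite /node_le /=; case: (cP _ hi) => /= dE.
    rewrite dE in hi hn *; case/orP: (own _ _ hi) => [/andP[/eqP xE /eqP yE]|].
      by rewrite xE yE eqxx in hn.
    by rewrite /G; lia.
  rewrite dE in hi *; have [hA'|hN] := boolP (addable lam (x, y, c')).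
    by move: (other _ _ hi hA'); rewrite /G; lia.
  have [/and4P[q0 _ hlt _] _] := rem _ _ hi hN; rewrite /G.
  by move: hlt q0; clear; lia.
- move=> [[x y] d] [[x' y'] d'] hi hi' hN hN'.
  have dE : d = c'.
    by case: (cP _ hi) => //= dE; move: hN; rewrite dE ownA // -dE.
  have dE' : d' = c'.
    by case: (cP _ hi') => //= dE'; move: hN'; rewrite dE' ownA // -dE'.
  rewrite {}dE {}dE' in hi hi' hN hN' *.
  (* [h] excludes the case of two removable corners in component [c']. *)
  have [/and4P[_ _ _ h] /(removable_block lamc')] := rem _ _ hi hN.
  have [_ /(removable_block lamc')] := rem _ _ hi' hN'.
  by move: h; clear; move=> h h1 h2; congr (_, _, _); lia.
- move=> [[x y] d] hi hN.
  have dE : d = c'.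
    by case: (cP _ hi) => //= dE; move: hN; rewrite dE ownA // -dE.
  rewrite {}dE in hi hN *.
  have [/and4P[q0 hm hlt _] _] := rem _ _ hi hN.
  (* The bottom node of component [c] is the addable node standing after R. *)
  have kA : addable lam ((a + b).+1, 1%N, c).
    by rewrite (addable_block lamc) q0 !eqxx !orbT.
  exists ((a + b).+1, 1%N, c); rewrite mem_inodes kA (addable_block_mem lamc) //=.
  split; last by rewrite /node_le /=; lia.
    rewrite andbT [X in (X == _ %[mod _])%Z](_ : _ = charge s c - (a + b)%:Z) //.
    by lia.
  by rewrite !xpair_eqE; lia.
Qed.

(** Equal contents are harmless here: at a tie the node of component 1 is the larger. *)
Lemma add_good_block1 (s : int * int) (e : nat) i q a b q' a' b'
    (G : int := q%:Z - a%:Z + s.1) :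
  (i == G %[mod e])%Z ->
  (a.+1 < e)%N -> (b < e)%N -> (0 < b)%N || (q == 0%N) ->
  (forall x, x \in addable_contents q' a' b' ->
     (x + s.2 == G %[mod e])%Z -> x + s.2 <= G) ->
  (forall x, x \in removable_contents q' a' b' ->
     (x + s.2 == G %[mod e])%Z -> False) ->
  add_good s e i (block q a b, block q' a' b')
  = Some (block q a.+1 b.-1, block q' a' b').
Proof.
move=> /eqP iG ae be bq hA hR; rewrite (add_good_mod _ _ iG) /add_good.
rewrite (@good_addable_block _ _ _ 1 2 q a b q' a' b') //= ?block_fill //.
  by move=> x hx /(hA _ hx) /=; rewrite le_eqVlt orbC.
by move=> x hx /(hR _ hx).
Qed.

Lemma add_good_block2 (s : int * int) (e : nat) i q a b q' a' b'
    (G : int := q%:Z - a%:Z + s.2) :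
  (i == G %[mod e])%Z ->
  (a.+1 < e)%N -> (b < e)%N -> (0 < b)%N || (q == 0%N) ->
  (forall x, x \in addable_contents q' a' b' ->
     (x + s.1 == G %[mod e])%Z -> x + s.1 < G) ->
  (forall x, x \in removable_contents q' a' b' ->
     (x + s.1 == G %[mod e])%Z ->
     [&& (0 < q)%N, (s.2 - (a + b)%:Z == G %[mod e])%Z,
         x + s.1 < s.2 - (a + b)%:Z
       & ~~ [&& (0 < a')%N, (0 < b')%N & (0 < q')%N]]) ->
  add_good s e i (block q' a' b', block q a b)
  = Some (block q' a' b', block q a.+1 b.-1).
Proof.
move=> /eqP iG ae be bq hA hR; rewrite (add_good_mod _ _ iG) /add_good.
rewrite (@good_addable_block _ _ _ 2 1 q a b q' a' b') //= ?block_fill //.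
by move=> x hx /(hA _ hx); rewrite orbF.
Qed.

(** * Paths of good additions and residue sequences *)

Lemma uglov_path (s : int * int) (e : nat) (r : seq int) (res : nat -> int)
    (mu : nat -> bipart) n :
  uglov s e r = Some (mu 0%N) ->
  (forall k, (k < n)%N -> add_good s e (res k) (mu k) = Some (mu k.+1)) ->
  uglov s e (r ++ [seq res k | k <- iota 0 n]) = Some (mu n).
Proof.
move=> h0; elim: n => [|n IH] hs; first by rewrite cats0.
rewrite -addn1 iotaD map_cat catA cats1 uglov_rcons IH => [|k kn].
  by rewrite /= hs // addn1.
by apply: hs; apply: ltnW.
Qed.

(** Steps are numbered [q * m + t], and stage [m] of round [q] is glued to stage 0 of round [q.+1].
    For columns, [m] is [e.-1]. *)
Lemma uglov_path_edivn (s : int * int) (e : nat) (r : seq int) (res : nat -> int) m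
    (mu : nat -> nat -> bipart) n : (0 < m)%N ->
  uglov s e r = Some (mu 0%N 0%N) -> (forall q, mu q m = mu q.+1 0%N) ->
  (forall q t, (t < m)%N ->
     add_good s e (res (q * m + t)%N) (mu q t) = Some (mu q t.+1)) ->
  uglov s e (r ++ [seq res k | k <- iota 0 n]) = Some (mu (n %/ m)%N (n %% m)%N).
Proof.
move=> m0 h0 hm hs; apply: (uglov_path (mu := fun k => mu (k %/ m)%N (k %% m)%N)).
  by rewrite div0n mod0n.
move=> k _; rewrite {1}(divn_eq k m) hs ?ltn_pmod // divnS // modnS.
case: ifP => [dk|_]; last by rewrite add0n.
(* As [m] divides [k.+1], the remainder of [k] is [m - 1]. *)
suff -> : (k %% m).+1 = m by rewrite hm add1n.
by move: dk; rewrite -addn1 /dvdn -modnDml; have := ltn_pmod k m0;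
  rewrite addn1 leq_eqVlt => /orP[/eqP //|h]; rewrite modn_small.
Qed.

Lemma one_dim_residues_row s n lam :
  size (lam.1 ++ lam.2) = 1%N ->
  one_dim_residues s n lam =
  [seq (if lam.2 == [::] then s.1 else s.2) + k%:Z | k <- iota 0 n].
Proof. by move=> h; rewrite /one_dim_residues h. Qed.

Lemma one_dim_residues_col s n lam : size (lam.1 ++ lam.2) = n ->
  one_dim_residues s n lam =
  [seq (if lam.2 == [::] then s.1 else s.2) - k%:Z | k <- iota 0 n].
Proof.
move=> h; rewrite /one_dim_residues h; case: eqP => [->|//].
(* For [n = 1] the shape is also a row, but the only index is [k = 0], where both signs agree. *)
by rewrite /=; congr [:: _]; case: ifP; lia.
Qed.

Lemma block_pos q : (0 < q)%N -> block q 0 1 = [:: q].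
Proof. by case: q. Qed.

Lemma block_ones a : block 0 a 0 = nseq a 1%N.
Proof. by rewrite blockE cats0. Qed.

Lemma mullineux_block e n :
  mullineux_row e n = block (n %/ e.-1) (n %% e.-1) (e.-1 - n %% e.-1).
Proof. by []. Qed.

Lemma eqz_modE (e : nat) (x y : int) :
  (x == y %[mod e])%Z <-> exists k : int, x = y + k * e%:Z.
Proof.
rewrite eqz_mod_dvd; split=> [/dvdzP[k h]|[k ->]].
  by exists k; rewrite -h addrC subrK.
by rewrite addrC addKr dvdz_mull.
Qed.

(** * Rows and columns, according to the size of [s.2 - s.1] *)

Section Paths.
Variables (s : int * int) (e : nat).
Hypotheses (he : (2 <= e)%N) (hs : s.1 < s.2).

(** The row grows as a single part [q = k]; the only node of component 1 is [(1, 1, 1)], of content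
    [s.1 < s.2 + k]. *)
Lemma uglov_row2 n : uglov s e [seq s.2 + k%:Z | k <- iota 0 n] =
  Some (block 0 0 0, block n 0 1).
Proof.
apply: (@uglov_path _ _ [::] _ (fun k => (_, block k 0 1))) => // k _.
rewrite -block_col; apply: add_good_block2 => //; try lia.
- by rewrite subr0 addrC.
- by move=> x; rewrite !inE => /eqP-> _; lia.
Qed.

(** As [s.2 < s.1 + e], the rival [(1, 1, 2)] is never above the end of the row when residues agree;
    at [k = s.2 - s.1] contents tie and component 1 wins. *)
Lemma uglov_row1_small n : s.2 < s.1 + e%:Z ->
  uglov s e [seq s.1 + k%:Z | k <- iota 0 n] = Some (block n 0 1, block 0 0 0).
Proof.
move=> hs'.
apply: (@uglov_path _ _ [::] _ (fun k => (block k 0 1, _))) => // k _.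
rewrite -block_col; apply: add_good_block1 => //; try lia.
- by rewrite subr0 addrC.
- move=> x; rewrite !inE => /eqP-> /eqz_mod_gap; lia.
Qed.

Lemma uglov_row1_le n j : (j < e)%N -> (j%:Z == s.2 - s.1 %[mod e])%Z ->
  (n <= j)%N ->
  uglov s e [seq s.1 + k%:Z | k <- iota 0 n] = Some (block n 0 1, block 0 0 0).
Proof.
move=> je /eqz_modE[t ht] nj.
apply: (@uglov_path _ _ [::] _ (fun k => (block k 0 1, _))) => // k kn.
rewrite -block_col; apply: add_good_block1 => //; try lia.
- by rewrite subr0 addrC.
- move=> x; rewrite !inE => /eqP-> /eqz_modE[t' ht'].
  (* The congruences give [j = k + (t + t') * e], impossible for [k < j < e]. *)
  suff : t + t' = 0 by nia.
  by nia.
Qed.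

Lemma iota_shift (res : nat -> int) j n :
  [seq res k | k <- iota 0 (j + n)] =
  [seq res k | k <- iota 0 j] ++ [seq res (j + k)%N | k <- iota 0 n].
Proof.
by rewrite iotaD map_cat add0n -[j in iota j n]addn0 iotaDl -map_comp.
Qed.

(** After [j] steps, [(1, j+1, 1)] and [(1, 1, 2)] share their residue, and the latter has larger
    content since [s.2 >= s.1 + e > s.1 + j]. Later the removable node [(1, j, 1)] has the residue
    of [s.2 - 1], that of the larger addable node [(2, 1, 2)], which cancels it. *)
Lemma uglov_row1_big n j : (j < e)%N -> (j%:Z == s.2 - s.1 %[mod e])%Z ->
  s.1 + e%:Z <= s.2 ->
  uglov s e [seq s.1 + k%:Z | k <- iota 0 (j + n)]
  = Some (block j 0 1, block n 0 1).
Proof.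
move=> je hj hs'; rewrite iota_shift.
apply: (@uglov_path _ _ _ _ (fun k => (_, block k 0 1))) => [|k _].
  by rewrite (uglov_row1_le je) // leqnn.
have /eqz_modE[t ht] := hj.
rewrite -block_col; apply: add_good_block2 => //; try lia.
- by apply/eqz_modE; exists t; lia.
- move=> x; rewrite !mem_cat !mem_nseq !lt0b => h _; lia.
- move=> x; rewrite !mem_cat !mem_nseq !lt0b => h /eqz_modE[t' ht'].
  have -> : (s.2 - (0 + 1)%:Z == k%:Z - 0%:Z + s.2 %[mod e])%Z.
    by apply/eqz_modE; exists (t' - t); lia.
  suff : k != 0%N by lia.
  (* For [k = 0] the congruences would give [-1 = (t' - t) * e]. *)
  apply/eqP => k0; suff : t' - t = 0 by nia.
  by nia.
Qed.

(** Columns of height [e.-1] are filled in turn: passing from the foot of one to the top of the next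
    raises the content by [e.-1], so it lowers the residue by 1, as a step down does. Contents stay
    above [s.1], that of the empty component. *)
Lemma uglov_col2_big n : s.1 + e%:Z <= s.2 ->
  uglov s e [seq s.2 - k%:Z | k <- iota 0 n]
  = Some (block 0 0 0, mullineux_row e n).
Proof.
move=> hs'; rewrite mullineux_block.
apply: (@uglov_path_edivn _ _ [::] _ e.-1
  (fun q r => (_, block q r (e.-1 - r)))) => [||q|q r hr].
- by lia.
- by rewrite !blockE.
- by rewrite subnn (block_col q) subn0.
rewrite subnS; apply: add_good_block2 => //; try lia.
- by apply/eqz_modE; exists (- q%:Z); nia.
- by move=> x; rewrite !inE => /eqP-> _; lia.
Qed.

Lemma uglov_col1_le n j : (j < e)%N ->
  (j%:Z == s.1 + e%:Z - s.2 %[mod e])%Z -> (n <= j)%N ->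
  uglov s e [seq s.1 - k%:Z | k <- iota 0 n] = Some (block 0 n 0, block 0 0 0).
Proof.
move=> je /eqz_modE[t ht] nj.
apply: (@uglov_path _ _ [::] _ (fun k => (block 0 k 0, _))) => // k kn.
apply: add_good_block1 => //; try lia.
- by apply/eqP; congr (_ %% _)%Z; lia.
- move=> x; rewrite !inE => /eqP-> /eqz_modE[t' ht'].
  (* The congruences give [j = k + (t + 1 - t') * e], impossible for [k < j < e]. *)
  suff : t + 1 - t' = 0 by nia.
  by nia.
Qed.

(** After [j] steps the residue is that of [s.2], and component 2 takes over. The removable foot of
    the first column has the residue of [s.2 + 1], that of the larger addable node in row [e] of
    component 2, which cancels it. *)
Lemma uglov_col1_big n j : (j < e)%N ->
  (j%:Z == s.1 + e%:Z - s.2 %[mod e])%Z -> s.1 + e%:Z <= s.2 ->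
  uglov s e [seq s.1 - k%:Z | k <- iota 0 (j + n)]
  = Some (block 0 j 0, mullineux_row e n).
Proof.
move=> je hj hs'; rewrite iota_shift mullineux_block.
apply: (@uglov_path_edivn _ _ _ _ e.-1
  (fun q r => (_, block q r (e.-1 - r)))) => [||q|q r hr].
- by lia.
- by rewrite (uglov_col1_le je) // !blockE.
- by rewrite subnn (block_col q) subn0.
have /eqz_modE[t ht] := hj.
rewrite subnS; apply: add_good_block2 => //; try lia.
- by apply/eqz_modE; exists (- q%:Z - t - 1); nia.
- by move=> x; rewrite !mem_cat !mem_nseq !lt0b => h _; lia.
- move=> x; rewrite !mem_cat !mem_nseq !lt0b => h /eqz_modE[t' ht'].
  have -> : (s.2 - (r + (e.-1 - r))%:Z == q%:Z - r%:Z + s.2 %[mod e])%Z.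
    by apply/eqz_modE; exists (t + t'); nia.
  suff : q != 0%N by lia.
  (* For [q = 0] the congruences would give [r + 1 = (t + t' + 1) * e], while [0 < r + 1 < e]. *)
  apply/eqP => q0; suff : t + t' + 1 = 0 by nia.
  by nia.
Qed.

(** Each column of height [e.-1] is cut into [d] top rows, in component 2, and the rest, in
    component 1. Since [s.2 = s.1 + d], the content still drops by one at the cut. *)
Lemma uglov_col2_small (d n : nat) : s.2 = s.1 + d%:Z -> (d < e)%N ->
  uglov s e [seq s.2 - k%:Z | k <- iota 0 n] =
  let q := (n %/ e.-1)%N in let r := (n %% e.-1)%N in
  Some (if (d <= r)%N then (block q (r - d) (e.-1 - r), block q d 0)
        else (block q 0 (e.-1 - d), block q r (d - r))).
Proof.
move=> sd de /=.
apply: (@uglov_path_edivn _ _ [::] _ e.-1 (fun q r =>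
    if (d <= r)%N then (block q (r - d) (e.-1 - r), block q d 0)
    else (block q 0 (e.-1 - d), block q r (d - r)))) => [||q|q r hr].
- by lia.
- by rewrite leqn0 gtn_eqF ?blockE //; lia.
- have [-> ->] : (d <= e.-1)%N /\ (d <= 0)%N = false by lia.
  by rewrite subnn subn0 !block_col.
have hm : (s.2 - (q * e.-1 + r)%N%:Z == q%:Z - r%:Z + s.2 %[mod e])%Z.
  by apply/eqz_modE; exists (- q%:Z); nia.
case: leqP => hdr.
  rewrite ifT ?(leqW hdr) // subSn // subnS.
  (* For [q = 0] and [r = d] the first empty rows of both components tie, and component 1 wins. *)
  apply: add_good_block1 => //; try lia.
  - by rewrite [X in (_ == X %[mod _])%Z](_ : _ = q%:Z - r%:Z + s.2) //; lia.
  - by move=> x; rewrite !mem_cat !mem_nseq !lt0b => h /eqz_mod_gap; lia.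
  - by move=> x; rewrite !mem_cat !mem_nseq !lt0b => h /eqz_mod_gap; lia.
(* At [r.+1 = d] the two descriptions agree: the upper piece of the column is just completed. *)
have -> : (if (d <= r.+1)%N then
    (block q (r.+1 - d) (e.-1 - r.+1), block q d 0)
    else (block q 0 (e.-1 - d), block q r.+1 (d - r.+1)))
  = (block q 0 (e.-1 - d), block q r.+1 (d - r).-1).
  case: leqP => h; last by rewrite subnS.
  have -> : d = r.+1 by lia.
  by rewrite subnn subSnn.
apply: add_good_block2 => //; try lia.
- by move=> x; rewrite !mem_cat !mem_nseq !lt0b => h _; lia.
- by move=> x; rewrite !mem_cat !mem_nseq !lt0b => h /eqz_mod_gap; lia.
Qed.

(** The same cut with the top [d] rows in component 1. As [s.2 + d = s.1 + e], contents in component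
    2 are [e] higher than the uncut column would have, with the same residues. *)
Lemma uglov_col1_small (d n : nat) : s.1 + e%:Z = s.2 + d%:Z -> (d < e)%N ->
  (0 < d)%N ->
  uglov s e [seq s.1 - k%:Z | k <- iota 0 n] =
  let q := (n %/ e.-1)%N in let r := (n %% e.-1)%N in
  Some (if (d <= r)%N then (block q d 0, block q (r - d) (e.-1 - r))
        else (block q r (d - r), block q 0 (e.-1 - d))).
Proof.
move=> sd de d0 /=.
apply: (@uglov_path_edivn _ _ [::] _ e.-1 (fun q r =>
    if (d <= r)%N then (block q d 0, block q (r - d) (e.-1 - r))
    else (block q r (d - r), block q 0 (e.-1 - d)))) => [||q|q r hr].
- by lia.
- by rewrite leqn0 gtn_eqF ?blockE //; lia.
- have [-> ->] : (d <= e.-1)%N /\ (d <= 0)%N = false by lia.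
  by rewrite subnn subn0 !block_col.
have hm : (s.1 - (q * e.-1 + r)%N%:Z == q%:Z - r%:Z + s.1 %[mod e])%Z.
  by apply/eqz_modE; exists (- q%:Z); nia.
case: leqP => hdr.
  rewrite ifT ?(leqW hdr) // subSn // subnS.
  apply: add_good_block2 => //; try lia.
  (* The extra [- 1] accounts for the jump by [e] between the components. *)
  - by apply/eqz_modE; exists (- q%:Z - 1); nia.
  - by move=> x; rewrite !mem_cat !mem_nseq !lt0b => h /eqz_mod_gap; lia.
  - by move=> x; rewrite !mem_cat !mem_nseq !lt0b => h /eqz_mod_gap; lia.
have -> : (if (d <= r.+1)%N then
    (block q d 0, block q (r.+1 - d) (e.-1 - r.+1))
    else (block q r.+1 (d - r.+1), block q 0 (e.-1 - d)))
  = (block q r.+1 (d - r).-1, block q 0 (e.-1 - d)).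
  case: leqP => h; last by rewrite subnS.
  have -> : d = r.+1 by lia.
  by rewrite subnn subSnn.
apply: add_good_block1 => //; try lia.
- by move=> x; rewrite !mem_cat !mem_nseq !lt0b => h /eqz_mod_gap; lia.
- by move=> x; rewrite !mem_cat !mem_nseq !lt0b => h /eqz_mod_gap; lia.
Qed.

End Paths.

Theorem mainTheorem8 (R : realType) (n e : nat) (eta : R[i]) (s : int * int)
    (hn : (1 <= n)%N) (he : (2 <= e)%N)
    (heta : e.-primitive_root eta) (hs : s.1 < s.2) :
  [/\ (* for s_2 < s_1 + e and n > j the image of ((n), empty) is itself, not
         ((j), (n - j)), which need not be an Uglov 2-partition: see
         Phi_charge01 *)
      theta_image eta s e n ([::], [:: n]) ([::], [:: n])
      /\ (forall j : nat, (j < e)%N -> (j%:Z = s.2 - s.1 %[mod e])%Z ->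
            theta_image eta s e n ([:: n], [::])
              (if (n <= j)%N || (s.2 < s.1 + e%:Z) then ([:: n], [::])
               else (part [:: j], part [:: (n - j)%N]))),
      s.1 + e%:Z <= s.2 ->
      theta_image eta s e n ([::], nseq n 1%N) ([::], mullineux_row e n)
      /\ (forall j : nat, (j < e)%N -> (j%:Z = s.1 + e%:Z - s.2 %[mod e])%Z ->
            theta_image eta s e n (nseq n 1%N, [::])
              (if (n <= j)%N then (nseq n 1%N, [::])
               else (nseq j 1%N, mullineux_row e (n - j))))
    & (* d = s_2 - s_1 and d' = s_1 + e - s_2 are positive here *)
      s.2 < s.1 + e%:Z ->
      forall q r d d' : nat,
        n = (q * (e - 1) + r)%N -> (r <= e - 2)%N ->
        d%:Z = s.2 - s.1 -> d'%:Z = s.1 + e%:Z - s.2 ->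
        theta_image eta s e n ([::], nseq n 1%N)
          (if (d <= r)%N
           then (part (nseq (r - d) q.+1 ++ nseq (e - 1 - r) q),
                 part (nseq d q.+1))
           else (part (nseq (e - 1 - d) q),
                 part (nseq r q.+1 ++ nseq (d - r) q)))
        /\ theta_image eta s e n (nseq n 1%N, [::])
             (if (d' <= r)%N
              then (part (nseq d' q.+1),
                    part (nseq (r - d') q.+1 ++ nseq (e - 1 - r) q))
              else (part (nseq r q.+1 ++ nseq (d' - r) q),
                    part (nseq (d - 1) q)))].
Proof.
have nE : (nseq n 1%N == [::]) = false by case: n hn.
have row1 mu : uglov s e [seq s.1 + k%:Z | k <- iota 0 n] = Some mu ->
    theta_image eta s e n ([:: n], [::]) mu.
  by move=> h; apply: theta_image_residues heta _; rewrite one_dim_residues_row.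
have row2 mu : uglov s e [seq s.2 + k%:Z | k <- iota 0 n] = Some mu ->
    theta_image eta s e n ([::], [:: n]) mu.
  by move=> h; apply: theta_image_residues heta _; rewrite one_dim_residues_row.
have col1 mu : uglov s e [seq s.1 - k%:Z | k <- iota 0 n] = Some mu ->
    theta_image eta s e n (nseq n 1%N, [::]) mu.
  move=> h; apply: theta_image_residues heta _.
  by rewrite one_dim_residues_col // cats0 size_nseq.
have col2 mu : uglov s e [seq s.2 - k%:Z | k <- iota 0 n] = Some mu ->
    theta_image eta s e n ([::], nseq n 1%N) mu.
  move=> h; apply: theta_image_residues heta _.
  by rewrite one_dim_residues_col /= ?size_nseq // nE.
split.
- split; first by apply: row2; rewrite uglov_row2 // block_pos.
  move=> j je /eqP hj; apply: row1.
  case: ifP => [|/negbT/norP[nj]].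
    case/orP=> h; first by rewrite (uglov_row1_le he hs je) // block_pos.
    by rewrite uglov_row1_small // block_pos.
  rewrite -leNgt => hs'.
  by rewrite -{1}(subnKC (_ : j <= n)%N) ?uglov_row1_big //; lia.
- move=> hs'; split; first by apply: col2; rewrite uglov_col2_big.
  move=> j je /eqP hj; apply: col1; case: leqP => nj.
    by rewrite (uglov_col1_le he hs je) // block_ones.
  by rewrite -{1}(subnKC (ltnW nj)) uglov_col1_big // block_ones.
move=> hs' q r d d'; rewrite subn1 => nqr hr hd hd'.
(* Here [d + d' = e]. *)
have -> : (d - 1)%N = (e.-1 - d')%N by lia.
have qE : (n %/ e.-1)%N = q by rewrite nqr divnMDl ?divn_small ?addn0 //; lia.
have rE : (n %% e.-1)%N = r by rewrite nqr modnMDl modn_small //; lia.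
split.
  apply: col2; rewrite (@uglov_col2_small _ _ _ _ d) /= ?qE ?rE; try lia.
  (* [block q d 0] becomes [block q.+1 0 d], which is [part (nseq d q.+1)] by computation. *)
  by rewrite (block_col q).
apply: col1; rewrite (@uglov_col1_small _ _ _ _ d') /= ?qE ?rE; try lia.
by rewrite (block_col q).
Qed.
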